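(* For every fixed integer $k$, there is a polynomial-time algorithm which, given a finite set $X$ and the family $\mathrm{irr}(\mathcal{C})$ of irreducible closed sets of an acyclic convex geometry $(X,\mathcal{C})$ whose premise-degree is at most $k$, outputs the critical base of $(X,\mathcal{C})$; and likewise for every fixed $k$ there is such a polynomial-time algorithm for acyclic convex geometries whose conclusion-degree is at most $k$.
   Context: A closure system on a finite set $X$ is a family $\mathcal{C}\subseteq 2^X$ with $X,\emptyset\in\mathcal{C}$, closed under intersection, with closure operator $\phi(A)=\bigcap\{C\in\mathcal{C}:A\subseteq C\}$. For $x\in X$, $\mathrm{irr}(x)$ is the family of inclusion-maximal members of $\mathcal{C}$ not containing $x$, and $\mathrm{irr}(\mathcal{C})=\bigcup_x\mathrm{irr}(x)$. An implicational base (IB) of $(X,\mathcal{C})$ is a set $\Sigma$ of implications $A\to B$ ($A,B\subseteq X$ disjoint) whose closed sets (sets $C$ with $A\subseteq C\Rightarrow B\subseteq C$ for all $A\to B\in\Sigma$) are exactly $\mathcal{C}$. Its implication graph has an arc $ab$ whenever $a\in A,b\in B$ for some $A\to B\in\Sigma$; $(X,\mathcal{C})$ is an acyclic convex geometry if it has an IB with acyclic implication graph. The premise-degree (resp. conclusion-degree) of $\Sigma$ is the maximum over $x$ of the number of implications whose premise (resp. conclusion) contains $x$; the premise-degree (resp. conclusion-degree) of $(X,\mathcal{C})$ is the least premise-degree (resp. conclusion-degree) of an IB of it. For $x\in X$, a minimal generator of $x$ is an inclusion-minimal $A\subseteq X\setminus\{x\}$ with $x\in\phi(A)$; it is a critical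 generator of $x$ if moreover $\phi(A)\setminus\{a,x\}\in\mathcal{C}$ for every $a\in A$. The critical base is $\{A\to b: b\in X,\ A \text{ a critical generator of } b\}$. Polynomial time is in $|X|+|\mathrm{irr}(\mathcal{C})|$. *)

(* Defs.v *)
From mathcomp Require Import all_boot all_order all_algebra.

Set Implicit Arguments.
Unset Strict Implicit.
Unset Printing Implicit Defensive.

(* The pair (A, B) stands for the implication A -> B. *)
Notation impl T := ({set T} * {set T})%type.

Section ClosureSystems.
Variable T : finType.
Implicit Types (C : {set {set T}}) (A B D : {set T}) (x : T).

Definition closure_system C : Prop :=
  [/\ setT \in C, set0 \in C
    & forall A B, A \in C -> B \in C -> A :&: B \in C].

Definition phi C A : {set T} := \bigcap_(D in C | A \subset D) D.

Definition irr_at C x : {set {set T}} :=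
  [set M | maxset (fun D => (D \in C) && (x \notin D)) M].

Definition irr C : {set {set T}} := \bigcup_(x : T) irr_at C x.

Implicit Type S : {set impl T}.

Definition closed_for S D : bool :=
  [forall i in S, (i.1 \subset D) ==> (i.2 \subset D)].

Definition is_IB C S : bool :=
  [forall i in S, [disjoint i.1 & i.2]] &&
  [forall D, (D \in C) == closed_for S D].

Definition arc S : rel T :=
  fun a b => [exists i in S, (a \in i.1) && (b \in i.2)].

Definition acyclic (e : rel T) : Prop :=
  forall c : seq T, cycle e c -> c = [::].

Definition acyclic_convex_geometry C : Prop :=
  closure_system C /\ (exists2 S, is_IB C S & acyclic (arc S)).

Definition base_premise_degree S : nat :=
  \max_(x : T) #|[set i in S | x \in i.1]|.

Definition base_conclusion_degree S : nat :=
  \max_(x : T) #|[set i in S | x \in i.2]|.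

(* An IB of every closure system (see [full_IBP]); it only serves as the seed
   that [arg min] requires. *)
Definition full_IB C : {set impl T} := [set (A, phi C A :\: A) | A : {set T}].

Definition premise_degree C : nat :=
  base_premise_degree
    [arg min_(S < full_IB C | is_IB C S) base_premise_degree S].

Definition conclusion_degree C : nat :=
  base_conclusion_degree
    [arg min_(S < full_IB C | is_IB C S) base_conclusion_degree S].

Definition minimal_generator C x A : bool :=
  minset (fun B => (B \subset [set~ x]) && (x \in phi C B)) A.

Definition critical_generators C x : {set {set T}} :=
  [set A | minimal_generator C x A &
           [forall a in A, phi C A :\: [set a; x] \in C]].

Definition critical_base C : {set impl T} :=
  [set (A, [set b]) | b in T, A in critical_generators C b].

Lemma phi_closed C A : closure_system C -> phi C A \in C.
Proof.
case=> CT _ CI; rewrite /phi.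
by elim/big_ind: _ => // D /andP[].
Qed.

Lemma full_IBP C : closure_system C -> is_IB C (full_IB C).
Proof.
move=> CC; apply/andP; split.
  apply/forall_inP=> i /imsetP[A _ ->] /=.
  by rewrite disjoint_sym disjoints_subset setDE subsetIr.
apply/forallP=> D; apply/eqP; apply/idP/forall_inP => [DC i /imsetP[A _ ->]|H] /=.
  apply/implyP=> AD; apply: subset_trans (subsetDl _ _) _.
  by apply: bigcap_inf; rewrite DC AD.
have /H /= : (D, phi C D :\: D) \in full_IB C by apply/imsetP; exists D.
rewrite subxx /= => sD; suff <- : phi C D = D by apply: phi_closed.
apply/eqP; rewrite eqEsubset; apply/andP; split.
  apply/subsetP=> y yp; apply/negPn/negP=> yD.
  by case/negP: (yD); apply: (subsetP sD); rewrite inE yD.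
by apply/bigcapsP=> E /andP[].
Qed.

Lemma premise_degree_leP C k : closure_system C ->
  premise_degree C <= k <->
  exists2 S, is_IB C S & base_premise_degree S <= k.
Proof.
move=> CC; rewrite /premise_degree; case: arg_minnP => [|S SI Smin].
  exact: full_IBP.
by split=> [|[S' /Smin h] /(leq_trans h)//]; exists S.
Qed.

Lemma conclusion_degree_leP C k : closure_system C ->
  conclusion_degree C <= k <->
  exists2 S, is_IB C S & base_conclusion_degree S <= k.
Proof.
move=> CC; rewrite /conclusion_degree; case: arg_minnP => [|S SI Smin].
  exact: full_IBP.
by split=> [|[S' /Smin h] /(leq_trans h)//]; exists S.
Qed.

End ClosureSystems.

(* Algorithms are programs of Jones's WHILE language over binary trees.
   Evaluating an expression is charged the sizes of the values of all its
   subexpressions, so no value can outgrow the time spent: running time is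
   polynomially related to that of multi-tape Turing machines. (Charging one
   unit per operation would not do: iterating x := cons x x builds trees of
   exponential size.) *)
Inductive tree : Type := Leaf | Node of tree & tree.

Fixpoint tree_size (t : tree) : nat :=
  if t is Node l r then (tree_size l + tree_size r).+1 else 1.

Fixpoint tree_eqb (t u : tree) : bool :=
  match t, u with
  | Leaf, Leaf => true
  | Node t1 t2, Node u1 u2 => tree_eqb t1 u1 && tree_eqb t2 u2
  | _, _ => false
  end.

Definition left_tree (t : tree) : tree := if t is Node l _ then l else Leaf.
Definition right_tree (t : tree) : tree := if t is Node _ r then r else Leaf.

Definition enc_bool (b : bool) : tree := if b then Node Leaf Leaf else Leaf.

Inductive expr : Type :=
  | EVar of nat
  | ENil
  | ECons of expr & expr
  | EHd of expr
  | ETl of expr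
  | EEq of expr & expr.

Inductive com : Type :=
  | CSkip
  | CAssign of nat & expr
  | CSeq of com & com
  | CIf of expr & com & com
  | CWhile of expr & com.

Definition store : Type := nat -> tree.

Definition update (st : store) (x : nat) (v : tree) : store :=
  fun y => if y == x then v else st y.

Fixpoint eval (st : store) (e : expr) : tree :=
  match e with
  | EVar x => st x
  | ENil => Leaf
  | ECons e1 e2 => Node (eval st e1) (eval st e2)
  | EHd e1 => left_tree (eval st e1)
  | ETl e1 => right_tree (eval st e1)
  | EEq e1 e2 => enc_bool (tree_eqb (eval st e1) (eval st e2))
  end.

Fixpoint eval_cost (st : store) (e : expr) : nat :=
  tree_size (eval st e) +
  match e with
  | EVar _ | ENil => 0
  | ECons e1 e2 | EEq e1 e2 => eval_cost st e1 + eval_cost st e2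
  | EHd e1 | ETl e1 => eval_cost st e1
  end.

Definition holds (st : store) (e : expr) : bool :=
  if eval st e is Node _ _ then true else false.

(* [exec c st t st']: started in st, c halts in st' after time t. *)
Inductive exec : com -> store -> nat -> store -> Prop :=
  | ExecSkip st : exec CSkip st 1 st
  | ExecAssign st x e :
      exec (CAssign x e) st (eval_cost st e).+1 (update st x (eval st e))
  | ExecSeq c1 c2 st t1 st1 t2 st2 :
      exec c1 st t1 st1 -> exec c2 st1 t2 st2 ->
      exec (CSeq c1 c2) st (t1 + t2).+1 st2
  | ExecIf e c1 c2 st t st' :
      exec (if holds st e then c1 else c2) st t st' ->
      exec (CIf e c1 c2) st (eval_cost st e + t).+1 st'
  | ExecWhileDone e c st :
      ~~ holds st e -> exec (CWhile e c) st (eval_cost st e).+1 st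
  | ExecWhileLoop e c st t1 st1 t2 st2 :
      holds st e -> exec c st t1 st1 -> exec (CWhile e c) st1 t2 st2 ->
      exec (CWhile e c) st (eval_cost st e + t1 + t2).+1 st2.

Lemma exec_deterministic c st t1 st1 t2 st2 :
  exec c st t1 st1 -> exec c st t2 st2 -> t1 = t2 /\ st1 = st2.
Proof.
move=> H; elim: H t2 st2 => {c st t1 st1}.
- by move=> st t2 st2 H; inversion H.
- by move=> st x e t2 st2 H; inversion H.
- move=> c1 c2 st t1 st1 t2 st2 _ IH1 _ IH2 t3 st3 H.
  inversion H as [| |? ? ? ? ? ? ? E1 E2| | |]; subst.
  by case: (IH1 _ _ E1) => ? ?; subst; case: (IH2 _ _ E2) => -> ->.
- move=> e c1 c2 st t st' _ IH t2 st2 H.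
  inversion H as [| | |? ? ? ? ? ? E| |]; subst.
  by case: (IH _ _ E) => -> ->.
- move=> e c st /negP nh t2 st2 H.
  by inversion H as [| | | | |? ? ? ? ? ? ? h E1 E2]; subst.
- move=> e c st t1 st1 t2 st2 h _ IH1 _ IH2 t3 st3 H.
  inversion H as [| | | |? ? ? nh|? ? ? ? ? ? ? h' E1 E2]; subst.
    by rewrite h in nh.
  by case: (IH1 _ _ E1) => ? ?; subst; case: (IH2 _ _ E2) => -> ->.
Qed.

Definition enc_seq (U : Type) (f : U -> tree) (s : seq U) : tree :=
  foldr (fun u t => Node (f u) t) Leaf s.

(* A subset is given by its characteristic vector, along [enum T]. *)
Definition enc_set (T : finType) (A : {set T}) : tree :=
  enc_seq enc_bool [seq x \in A | x <- enum T].

Definition enc_impl (T : finType) (i : impl T) : tree :=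
  Node (enc_set i.1) (enc_set i.2).

(* The ground set is given by a list of #|T| dummy items. *)
Definition enc_input (T : finType) (s : seq {set T}) : tree :=
  Node (enc_seq (fun _ : T => Leaf) (enum T)) (enc_seq (@enc_set T) s).

(* Variable 0 holds the input at the start and the output at the end. *)
Definition init_store (v : tree) : store := update (fun=> Leaf) 0 v.

Definition lists (U : finType) (s : seq U) (A : {set U}) : Prop :=
  uniq s /\ s =i A.

Definition poly_time_critical_base
    (P : forall T : finType, {set {set T}} -> Prop) (p : com) : Prop :=
  exists q : {poly nat},
  forall (T : finType) (C : {set {set T}}) (s : seq {set T}),
    P T C -> lists s (irr C) ->
    exists (t : nat) (st : store) (o : seq (impl T)),
      [/\ exec p (init_store (enc_input s)) t st,
          t <= q.[(#|T| + #|irr C|)%N]%R,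
          st 0 = enc_seq (@enc_impl T) o
        & lists o (critical_base C)].

(* Main.v *)
Require Import Defs.
From mathcomp Require Import all_boot all_algebra zify.

Set Implicit Arguments.
Unset Strict Implicit.
Unset Printing Implicit Defensive.

(* A critical generator A of x is recovered from its closure as the set of
   extreme points of phi A, and phi A is the intersection of the irreducible
   sets M with x in phi (M :&: D) as soon as the region D satisfies
     x \in phi (F :&: D)  <->  A \subset F    for all closed F.
   In every implicational base, A is spanned by a premise whose conclusion
   contains x. Hence a bound k on the conclusion-degree (premise-degree) bounds
   the number of critical generators of x (of critical premises containing y).
   - Conclusion-degree: some intersection N of k irreducible sets contains A and
     no other critical generator of x; take D = N \ x.
   - Premise-degree: fix y in A. Some intersection N of k irreducible sets
     contains A and no critical premise through y that is not already inside
     phi A. As phi A \ {x, y} is closed, it lies in an irreducible set M that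
     avoids x. Take D = (N & M) + y: an implication of the critical base that
     fails in F & D can only be A -> x.
   There are polynomially many regions, and each candidate is tested. *)

(** * The algorithm on sets *)

Section Algorithm.
Variables (T : finType) (s : seq {set T}).
Implicit Types (A D F M N : {set T}) (x y z : T) (Ns Ds : seq {set T}).

Definition closure_by A : {set T} :=
  [set z | all (fun M => (A \subset M) ==> (z \in M)) s].

Definition closed_by A : bool := closure_by A == A.

Definition extreme_by F : {set T} := [set e | (e \in F) && closed_by (F :\ e)].

Definition hull D x : {set T} :=
  [set z | all (fun M => (x \in closure_by (M :&: D)) ==> (z \in M)) s].

Definition critical_by A x : bool :=
  [&& x \notin A, x \in closure_by A
    & all (fun a => (a \in A) ==> closed_by (closure_by A :\: [set a; x]))
          (enum T)].

(** The accumulator starts at [Ns], so a round keeps the old sets: [meets k] holds all intersections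
    of at most k members of [s]. A round multiplies the length by 1 + [size s], which stays
    polynomial for fixed k. *)
Definition meet_all Ns : seq {set T} :=
  foldl (fun acc N => foldl (fun acc M => N :&: M :: acc) acc s) Ns Ns.

Definition meets k : seq {set T} := iter k meet_all [:: setT].

(** Both shapes are listed so that one search serves both degrees: [N :|: [set y]] for the
    premise-degree, [N :\: [set y]] for the conclusion-degree. *)
Definition regions Ns : seq {set T} :=
  foldl (fun acc N =>
    foldl (fun acc y => N :|: [set y] :: N :\: [set y] :: acc) acc (enum T))
    [::] Ns.

(** The test makes every output sound, whatever the region [D]; only completeness depends on the
    choice of regions. *)
Definition add_critical D x (acc : seq (impl T)) : seq (impl T) :=
  let i := (extreme_by (hull D x), [set x]) in
  if critical_by i.1 x && (i \notin acc) then i :: acc else acc.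

Definition critical_search Ds : seq (impl T) :=
  foldl (fun acc D => foldl (fun acc x => add_critical D x acc) acc (enum T))
    [::] Ds.

End Algorithm.

(** * Correctness in acyclic convex geometries *)

(** Take x in [A] with the fewest ancestors. Given an arc from y to x, every ancestor of y is one of
    x, while x is not an ancestor of y by acyclicity; so y would have strictly fewer. *)
Lemma acyclic_source (T : finType) (e : rel T) (A : {set T}) : acyclic e ->
  A != set0 -> exists2 x, x \in A & forall y, y \in A -> ~~ e y x.
Proof.
move=> acy /set0Pn[x0 x0A].
case: (arg_minnP (fun x => #|[set z | connect e z x]|) x0A) => x xA xmin.
exists x => // y yA; apply/negP=> eyx.
have: [set z | connect e z y] \proper [set z | connect e z x].
  apply/properP; split.
    apply/subsetP=> z; rewrite !inE => /connect_trans; apply.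
    exact: connect1.
  exists x; rewrite !inE ?connect0 //; apply/negP => /connectP[p ep yl].
  suff /acy : cycle e (x :: p) by [].
  by rewrite /= rcons_path ep -yl.
by move/proper_card; rewrite ltnNge xmin.
Qed.

Lemma mem_foldl_sub (U : Type) (V : eqType) (f : seq V -> U -> seq V) r acc :
  (forall acc u, {subset acc <= f acc u}) -> {subset acc <= foldl f acc r}.
Proof.
move=> fs; elim: r acc => [|u r IH] acc v vacc //=; exact/IH/fs.
Qed.

Lemma mem_foldl (U V : eqType) (f : seq V -> U -> seq V) r u v :
  (forall acc u, {subset acc <= f acc u}) -> (forall acc, v \in f acc u) ->
  u \in r -> forall acc, v \in foldl f acc r.
Proof.
move=> fs fv; elim: r => //= w r IH; rewrite inE => /predU1P[<-|/IH//] acc.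
exact: (@mem_foldl_sub _ _ f r (f acc u)).
Qed.

Lemma foldl_inv (U : Type) (V : Type) (P : V -> Prop) (f : V -> U -> V) r acc :
  (forall acc u, P acc -> P (f acc u)) -> P acc -> P (foldl f acc r).
Proof. by move=> fP; elim: r acc => //= u r IH acc Pa; apply/IH/fP. Qed.

(** * Closure operator, irreducible sets and extreme points *)

Section ConvexGeometry.
Variables (T : finType) (C : {set {set T}}).
Implicit Types (A B D F K M N : {set T}) (x y z : T).
Hypothesis clC : closure_system C.

Lemma setI_closed A B : A \in C -> B \in C -> A :&: B \in C.
Proof. by case: clC => _ _; apply. Qed.

Lemma subset_phi A : A \subset phi C A.
Proof. by apply/bigcapsP=> D /andP[]. Qed.

Lemma phi_sub A D : A \subset D -> D \in C -> phi C A \subset D.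
Proof. by move=> AD DC; apply: bigcap_inf; rewrite DC. Qed.

Lemma phi_mono A B : A \subset B -> phi C A \subset phi C B.
Proof.
move=> AB; apply: phi_sub (phi_closed _ clC).
exact: subset_trans AB (subset_phi B).
Qed.

Lemma phi_id D : D \in C -> phi C D = D.
Proof. by move=> DC; apply/eqP; rewrite eqEsubset subset_phi phi_sub. Qed.

Lemma closed_phiE D : (D \in C) = (phi C D == D).
Proof.
apply/idP/eqP => [/phi_id //|<-]; exact: phi_closed.
Qed.

Lemma irr_closed M : M \in irr C -> M \in C.
Proof. by case/bigcupP=> x _; rewrite inE => /maxsetP[/andP[]]. Qed.

Lemma irr_at_above D x : D \in C -> x \notin D ->
  exists M, [/\ M \in irr C, D \subset M & x \notin M].
Proof.
move=> DC xD.
have [M maxM DM] := @maxset_exists _ (fun E => (E \in C) && (x \notin E)) D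
  (introT andP (conj DC xD)).
exists M; split=> //.
  by apply/bigcupP; exists x => //; rewrite inE.
by case/maxsetP: maxM => /andP[].
Qed.

(** A closed set that misses x lies below a maximal one, so the irreducible sets alone determine the
    closure operator. *)
Lemma mem_phi_irr A x :
  (x \in phi C A) = [forall M in irr C, (A \subset M) ==> (x \in M)].
Proof.
apply/idP/forall_inP => [xA M /irr_closed MC|H].
  by apply/implyP=> AM; apply: subsetP xA; apply: phi_sub.
apply/negPn/negP=> xA.
have [M [Mi AM /negP[]]] := irr_at_above (phi_closed A clC) xA.
by have /implyP := H _ Mi; apply; apply: subset_trans AM; apply: subset_phi.
Qed.

Definition extreme D : {set T} := [set e in D | D :\ e \in C].

Lemma extreme_sub D : extreme D \subset D.
Proof. by apply/subsetP=> e; rewrite inE => /andP[]. Qed.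

(** An extreme point outside [A] could be deleted from [phi C A], leaving a smaller closed set that
    still contains [A]. *)
Lemma sub_extreme_phi A : extreme (phi C A) \subset A.
Proof.
apply/subsetP=> e; rewrite inE => /andP[eA eC]; apply/negPn/negP=> neA.
have /subsetP/(_ e eA) : phi C A \subset phi C A :\ e.
  by apply: phi_sub eC; rewrite subsetD1 subset_phi.
by rewrite !inE eqxx.
Qed.

(** If a were outside [B], the closed set [F :\: [set a; x]] would contain [B] and hence x. With [F]
    equal to [phi C A], this makes every point of a critical generator unavoidable inside its
    closure. *)
Lemma phi_avoid F B a x : F :\: [set a; x] \in C -> B \subset F ->
  x \notin B -> x \in phi C B -> a \in B.
Proof.
move=> cF BF xB xpB; apply/negPn/negP=> aB.
have /subsetP/(_ x xpB) : phi C B \subset F :\: [set a; x].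
  apply: phi_sub cF; apply/subsetP=> b bB.
  rewrite !inE (subsetP BF) // andbT negb_or.
  by apply/andP; split; [apply: contraNneq aB | apply: contraNneq xB] => <-.
by rewrite !inE eqxx orbT.
Qed.

Lemma critical_generatorP x A :
  reflect [/\ x \notin A, x \in phi C A
            & forall a, a \in A -> phi C A :\: [set a; x] \in C]
          (A \in critical_generators C x).
Proof.
rewrite inE; apply: (iffP andP) => [[mA /forall_inP cA]|[xA xpA cA]].
  case/minsetP: mA => /andP[sA xA] _; split=> //.
  by move: sA; rewrite subsetC sub1set inE.
split; last by apply/forall_inP.
apply/minsetP; split=> [|B /andP[Bx xB] BA].
  by rewrite subsetC sub1set inE xA.
(* Closedness of the sets [phi C A :\: [set a; x]] forces minimality: a generator of x inside [A]
   contains every a in [A]. *)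
apply/eqP; rewrite eqEsubset BA; apply/subsetP=> a /cA/phi_avoid; apply=> //.
  exact: subset_trans BA (subset_phi A).
by apply: contra xA; apply/subsetP.
Qed.

Lemma critical_generator_sub A B x :
  A \in critical_generators C x -> B \subset phi C A -> x \notin B ->
  x \in phi C B -> A \subset B.
Proof.
case/critical_generatorP=> xA xpA cA BA xB xpB.
by apply/subsetP=> a /cA/phi_avoid; apply.
Qed.

Lemma critical_generator_inj A B x :
  A \in critical_generators C x -> B \in critical_generators C x ->
  B \subset phi C A -> B = A.
Proof.
move=> cA cB BA; have /critical_generatorP[xA xpA _] := cA.
have /critical_generatorP[xB xpB _] := cB.
have AB : A \subset B by apply: critical_generator_sub cA _ _ _.
apply/eqP; rewrite eqEsubset AB andbT; apply: critical_generator_sub cB _ _ _ => //.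
exact: subset_trans AB (subset_phi B).
Qed.

(** [phi C A :\ x] is not closed, so an implication of [S] fails there. It holds on [phi C A], hence
    its conclusion contains x; its premise then generates x inside [phi C A], so it contains [A] by
    criticality. *)
Lemma critical_generator_IB S A x : is_IB C S ->
  A \in critical_generators C x ->
  exists i, [/\ i \in S, A \subset i.1, i.1 \subset phi C A & x \in i.2].
Proof.
case/andP=> _ /forallP IB cA; have /critical_generatorP[xA xpA _] := cA.
have nC : phi C A :\ x \notin C.
  apply/negP=> xC; have /subsetP/(_ x xpA) : phi C A \subset phi C A :\ x.
    by apply: phi_sub xC; rewrite subsetD1 subset_phi.
  by rewrite !inE eqxx.
have := nC; rewrite (eqP (IB _)) negb_forall_in.
case/exists_inP=> i iS; rewrite negb_imply => /andP[iA niA].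
have := phi_closed A clC; rewrite (eqP (IB _)) => /forall_inP/(_ i iS)/implyP.
move: (iA); rewrite subsetD1 => /andP[iA' xi] /(_ iA') i2A.
have xi2 : x \in i.2.
  by apply: contraNT niA => xi2; rewrite subsetD1 i2A.
exists i; split=> //; apply: critical_generator_sub cA _ xi _ => //.
have := phi_closed i.1 clC; rewrite (eqP (IB _)) => /forall_inP/(_ i iS)/implyP.
by move=> /(_ (subset_phi _)) /subsetP; apply.
Qed.

(** * Consequences of acyclicity *)

Variable S : {set impl T}.
Hypotheses (IBS : is_IB C S) (acyS : acyclic (Defs.arc S)).

(** A source e of [F :\: G] can be deleted: if e is in the conclusion of an implication with premise
    in [F], no arc into e starts in [F :\: G], so the premise lies in [G], and closedness of [G]
    would put e in [G]. *)
Lemma accessible F G : F \in C -> G \in C -> G \proper F ->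
  exists2 e, e \in F :\: G & F :\ e \in C.
Proof.
case/andP: IBS => _ /forallP IB FC GC /properP[GF [f fF fG]].
have [|e eFG emin] := @acyclic_source _ _ (F :\: G) acyS.
  by apply/set0Pn; exists f; rewrite inE fG.
exists e => //; rewrite (eqP (IB _)); apply/forall_inP=> i iS; apply/implyP=> iF.
move: FC GC; rewrite !(eqP (IB _)) => /forall_inP/(_ i iS)/implyP iF2.
move=> /forall_inP/(_ i iS)/implyP iG.
move: iF; rewrite !subsetD1 => /andP[iF ei]; rewrite iF2 //=.
apply/negP=> ei2; case/setDP: eFG => _ /negP[]; apply: (subsetP (iG _)) (ei2).
apply/subsetP=> a ai; apply/negPn/negP=> aG.
have /emin/negP[] : a \in F :\: G by rewrite inE aG (subsetP iF).
by apply/exists_inP; exists i; rewrite ?ai.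
Qed.

(** If the extreme points spanned a smaller closed set, [accessible] would give a deletable point of
    [F] outside it, and such a point is extreme. *)
Lemma phi_extreme F : F \in C -> phi C (extreme F) = F.
Proof.
move=> FC; apply/eqP; rewrite eqEproper phi_sub ?extreme_sub //=.
apply/negP=> /(accessible FC (phi_closed _ clC))[e /setDP[eF /negP neF] eC].
by apply/neF/(subsetP (subset_phi _)); rewrite inE eF.
Qed.

(** The extreme points of [phi C A] lie in [A] and generate x, so by criticality they are all of
    [A]. *)
Lemma extreme_critical A x :
  A \in critical_generators C x -> extreme (phi C A) = A.
Proof.
move=> cA; have /critical_generatorP[xA xpA _] := cA.
apply/eqP; rewrite eqEsubset sub_extreme_phi /=.
apply: critical_generator_sub cA _ _ _; first exact: extreme_sub.
  by apply: contra xA; apply/subsetP/sub_extreme_phi.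
by rewrite phi_extreme ?phi_closed.
Qed.

Lemma extreme_phi_between A B : A \subset B -> B \subset phi C A ->
  extreme (phi C B) = extreme (phi C A).
Proof.
move=> AB BA; congr extreme; apply/eqP.
by rewrite eqEsubset phi_sub ?phi_closed // phi_mono.
Qed.

(* A minimal closed F in which x is still generated by F :\ x is spanned by a
   critical generator. *)
Lemma critical_generator_exists D x : x \notin D -> x \in phi C D ->
  exists2 A, A \in critical_generators C x & A \subset phi C D.
Proof.
move=> xD xpD; pose P F := (F \in C) && (x \in phi C (F :\ x)).
have PD : P (phi C D).
  rewrite /P phi_closed //=; apply: subsetP xpD; apply: phi_mono.
  by rewrite subsetD1 subset_phi.
have [F /minsetP[/andP[FC xF] Fmin] FD] := minset_exists PD.
have xF' : x \in F.
  by apply: subsetP xF; apply: phi_sub FC; apply: subsetDl.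
have xE : x \notin extreme F.
  rewrite inE xF' /=; apply: contraL xF => /phi_id->.
  by rewrite !inE eqxx.
exists (extreme F); last exact: subset_trans (extreme_sub F) FD.
apply/critical_generatorP; rewrite phi_extreme //; split=> // e.
rewrite inE => /andP[eF eC].
have -> : F :\: [set e; x] = (F :\ e) :\ x by rewrite setDDl.
(* Otherwise [F :\ e] would satisfy [P], against the minimality of [F]. *)
have nx : x \notin phi C (F :\ e :\ x).
  apply/negP=> xe; have /setP/(_ e) : F :\ e = F.
    by apply: Fmin (subsetDl _ _); rewrite /P eC.
  by rewrite !inE eqxx eF.
rewrite closed_phiE eqEsubset subset_phi andbT subsetD1 nx andbT.
by apply: phi_sub eC; apply: subsetDl.
Qed.

(** Let z be a source of [phi C D :\: D] and A a critical generator of z inside [phi C D]. By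
    [critical_generator_IB] every point of A has an arc to z, so none lies in [phi C D :\: D], and A
    is contained in [D]. *)
Lemma critical_base_IB D : D \notin C ->
  exists z, exists2 A, A \in critical_generators C z & A \subset D /\ z \notin D.
Proof.
move=> DC; have nD : phi C D :\: D != set0.
  apply: contra DC; rewrite setD_eq0 closed_phiE eqEsubset => ->.
  exact: subset_phi.
have [z /setDP[zp zD] zmin] := acyclic_source acyS nD.
have [A cA AD] := critical_generator_exists zD zp.
exists z; exists A => //; split=> //; apply/subsetP=> a aA; apply/negPn/negP=> aD.
have /zmin/negP[] : a \in phi C D :\: D by rewrite inE aD (subsetP AD).
have [i [iS Ai _ zi]] := critical_generator_IB IBS cA.
by apply/exists_inP; exists i; rewrite ?zi ?andbT ?(subsetP Ai).
Qed.

(** * Counting critical generators by the degrees *)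

(** For the implication i that [critical_generator_IB] attaches to A, the premise [i.1] lies between
    A and [phi C A], so A is [extreme (phi C i.1)]. Hence the implications with x in the conclusion
    cover the critical generators of x. *)
Lemma card_critical_generators k x : conclusion_degree C <= k ->
  #|critical_generators C x| <= k.
Proof.
case/(conclusion_degree_leP _ clC) => R IBR; apply: leq_trans.
apply: leq_trans (leq_bigmax x).
apply: leq_trans (leq_imset_card (fun i : impl T => extreme (phi C i.1)) _).
apply/subset_leq_card/subsetP => A cA.
have [i [iR Ai iA xi]] := critical_generator_IB IBR cA.
apply/imsetP; exists i; first by rewrite inE iR.
by rewrite (extreme_phi_between Ai iA) (extreme_critical cA).
Qed.

(** Premises are counted, not implications: one premise may be critical for many x, which a single
    implication of a base can gather in its conclusion. *)
Definition critical_premises y : {set {set T}} :=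
  [set A : {set T} | (y \in A) && [exists x, A \in critical_generators C x]].

Lemma card_critical_premises k y : premise_degree C <= k ->
  #|critical_premises y| <= k.
Proof.
case/(premise_degree_leP _ clC) => R IBR; apply: leq_trans.
apply: leq_trans (leq_bigmax y).
apply: leq_trans (leq_imset_card (fun i : impl T => extreme (phi C i.1)) _).
apply/subset_leq_card/subsetP => A; rewrite inE => /andP[yA /existsP[x cA]].
have [i [iR Ai iA _]] := critical_generator_IB IBR cA.
apply/imsetP; exists i; first by rewrite inE iR (subsetP Ai).
by rewrite (extreme_phi_between Ai iA) (extreme_critical cA).
Qed.

(** * Correctness of the search on sets *)

Variable s : seq {set T}.
Hypothesis sE : s =i irr C.

Lemma closure_byE A : closure_by s A = phi C A.
Proof.
apply/setP=> z; rewrite inE mem_phi_irr; apply/allP/forall_inP => H M.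
  by rewrite -sE; apply: H.
by rewrite sE; apply: H.
Qed.

Lemma closed_byE A : closed_by s A = (A \in C).
Proof. by rewrite /closed_by closure_byE closed_phiE. Qed.

Lemma extreme_byE F : extreme_by s F = extreme F.
Proof. by apply/setP=> e; rewrite !inE closed_byE. Qed.

Lemma critical_byE A x : critical_by s A x = (A \in critical_generators C x).
Proof.
rewrite /critical_by closure_byE; apply/and3P/critical_generatorP.
  case=> xA xpA /allP H; split=> // a aA.
  by have := H a; rewrite mem_enum aA closed_byE => /(_ isT).
case=> xA xpA H; split=> //; apply/allP=> a _; apply/implyP=> /H.
by rewrite closed_byE.
Qed.

Lemma meet_all_sub Ns : {subset Ns <= meet_all s Ns}.
Proof.
move=> N NNs; apply: mem_foldl_sub NNs => acc u.
by apply: mem_foldl_sub => acc' M N'; rewrite inE orbC => ->.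
Qed.

Lemma mem_meet_all Ns N M : N \in Ns -> M \in s -> N :&: M \in meet_all s Ns.
Proof.
move=> NNs Ms; apply: (mem_foldl (u := N)) NNs _ => [acc u|acc].
  by apply: mem_foldl_sub => acc' M' N'; rewrite inE orbC => ->.
apply: (mem_foldl (u := M)) Ms _ => [acc' u N'|acc']; rewrite inE ?eqxx //.
by rewrite orbC => ->.
Qed.

Lemma mem_regions Ns N y : N \in Ns ->
  N :|: [set y] \in regions Ns /\ N :\: [set y] \in regions Ns.
Proof.
move=> NNs; split.
all: apply: (mem_foldl (u := N)) NNs _ => [acc u|acc];
  first by apply: mem_foldl_sub => acc' z N'; rewrite !inE => ->; rewrite !orbT.
all: apply: (mem_foldl (u := y)) (mem_enum _ _) _ => [acc' u N'|acc'];
  rewrite !inE ?eqxx ?orbT //.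
all: by move=> ->; rewrite !orbT.
Qed.

(** Each B has a point outside [phi C A], and some irreducible set contains [phi C A] and misses
    that point. One such set per B is intersected; once [Bs] is exhausted the intersection is
    kept. *)
Lemma meets_separate k A (Bs : {set {set T}}) : #|Bs| <= k ->
  (forall B, B \in Bs -> ~~ (B \subset phi C A)) ->
  exists N, [/\ N \in meets s k, N \in C, A \subset N
              & forall B, B \in Bs -> ~~ (B \subset N)].
Proof.
elim: k Bs => [|k IH] Bs.
  rewrite leqn0 cards_eq0 => /eqP-> _; exists setT.
  case: clC => CT _ _; rewrite subsetT inE CT eqxx; split=> // B.
  by rewrite inE.
case: (set_0Vmem Bs) => [->|[B BBs]] cB nB.
  have [||N [Nk NC AN _]] := IH set0; first by rewrite cards0.
    by move=> B; rewrite inE.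
  by exists N; split=> //; [apply: meet_all_sub | move=> B; rewrite inE].
have [||N [Nk NC AN nN]] := IH (Bs :\ B).
- by move: cB; rewrite (cardsD1 B) BBs ltnS.
- by move=> B' /setD1P[_ /nB].
have /subsetPn[b bB bA] := nB _ BBs.
have [M [Mi AM bM]] := irr_at_above (phi_closed A clC) bA.
exists (N :&: M); split.
- by apply: mem_meet_all Nk _; rewrite sE.
- by apply: setI_closed NC (irr_closed Mi).
- by rewrite subsetI AN (subset_trans (subset_phi A)).
move=> B' B'Bs; rewrite subsetI negb_and.
have [->|nBB'] := eqVneq B' B; last by rewrite nN // !inE nBB'.
by apply/orP; right; apply/subsetPn; exists b.
Qed.

Lemma hullE D A x :
  (forall F, F \in C -> (x \in phi C (F :&: D)) = (A \subset F)) ->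
  hull s D x = phi C A.
Proof.
move=> H; rewrite -closure_byE; apply/setP=> z; rewrite !inE.
apply: eq_in_all => M; rewrite sE => /irr_closed MC.
by rewrite closure_byE H.
Qed.

Lemma extreme_hull D A x : A \in critical_generators C x ->
  (forall F, F \in C -> (x \in phi C (F :&: D)) = (A \subset F)) ->
  extreme_by s (hull s D x) = A.
Proof. by move=> cA /hullE->; rewrite extreme_byE (extreme_critical cA). Qed.

Lemma conclusion_region k A x : conclusion_degree C <= k ->
  A \in critical_generators C x ->
  exists2 D, D \in regions (meets s k.+1) & extreme_by s (hull s D x) = A.
Proof.
move=> dk cA; have [xA xpA _] := elimT (critical_generatorP _ _) cA.
have [||N [Nk NC AN nN]] := @meets_separate k.+1 A (critical_generators C x :\ A).
- apply: leq_trans (subset_leq_card (subsetDl _ _)) _.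
  exact: leq_trans (card_critical_generators x dk) _.
- move=> B /setD1P[nBA cB]; apply: contra nBA => BA.
  by rewrite (critical_generator_inj cA cB BA).
(* With x deleted, x can only be generated, so [critical_generator_exists] yields a critical
   generator of x inside both F and [N]; it can only be [A]. *)
exists (N :\: [set x]); first by have [] := mem_regions x Nk.
apply: (extreme_hull cA) => F FC; apply/idP/idP => [xF|AF].
  have [|B cB BF] := critical_generator_exists _ xF.
    by rewrite !inE eqxx !andbF.
  have {}BF : B \subset F :&: N.
    apply: subset_trans BF _; apply: phi_sub; last exact: setI_closed.
    by rewrite setIS ?subsetDl.
  suff <- : B = A by apply: subset_trans BF (subsetIl _ _).
  apply/eqP/negPn/negP=> nBA; have /negP[] : ~~ (B \subset N).
    by apply: nN; rewrite in_setD1 nBA.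
  exact: subset_trans BF (subsetIr _ _).
by apply: subsetP xpA; apply: phi_mono; rewrite subsetI AF subsetD1 AN.
Qed.

Lemma premise_region k A x : premise_degree C <= k ->
  A \in critical_generators C x ->
  exists2 D, D \in regions (meets s k.+1) & extreme_by s (hull s D x) = A.
Proof.
move=> dk cA; have [xA xpA clA] := elimT (critical_generatorP _ _) cA.
(* The empty set is closed, so it generates nothing. *)
have /set0Pn[y yA] : A != set0.
  apply: contraTneq xpA => ->; rewrite phi_id ?inE //; by case: clC.
have yx : y != x by apply: contraNneq xA => <-.
pose Bs := [set B in critical_premises y | ~~ (B \subset phi C A)].
have [||N1 [N1k N1C AN1 nN1]] := @meets_separate k A Bs.
- apply: leq_trans (card_critical_premises y dk).
  by apply/subset_leq_card/subsetP=> B; rewrite inE => /andP[].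
- by move=> B; rewrite inE => /andP[].
(* One irreducible set beyond the k that make up [N1]: it avoids x and contains all of [phi C A]
   except possibly y and x. *)
have [|M [Mi AM xM]] := irr_at_above (clA _ yA) (x := x).
  by rewrite !inE eqxx orbT.
have MC := irr_closed Mi.
have phiAN1 : phi C A \subset N1 by apply: phi_sub.
pose K := N1 :&: M; have KC : K \in C by apply: setI_closed.
have inK z : z \in phi C A -> z != y -> z != x -> z \in K.
  move=> zA zy zx; rewrite inE (subsetP phiAN1) // (subsetP AM) //.
  by rewrite !inE zA negb_or zy zx.
have xK : x \notin K by rewrite inE (negbTE xM) andbF.
exists (K :|: [set y]).
  by have [] := mem_regions y (mem_meet_all N1k (M := M) _); rewrite ?sE.
apply: (extreme_hull cA) => F FC; apply/idP/idP => [xF|AF]; last first.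
  apply: subsetP xpA; apply: phi_mono; rewrite subsetI AF.
  apply/subsetP=> a aA; rewrite !inE; have [//|ay] := eqVneq a y.
    by rewrite orbT.
  rewrite orbF -in_setI; apply: inK => //; first exact: (subsetP (subset_phi A)).
  by apply: contraNneq xA => <-.
(* This set misses x but generates it, so it is not closed and a critical implication B -> z fails
   on it. *)
have nDC : F :&: (K :|: [set y]) \notin C.
  apply: contraL xF => /phi_id->.
  by rewrite !inE negb_and negb_or negb_and xM orbT eq_sym yx orbT.
have [z [B cB [BD zD]]] := critical_base_IB nDC.
have [zB zpB _] := elimT (critical_generatorP _ _) cB.
have BF : B \subset F by apply: subset_trans BD (subsetIl _ _).
have BKy : B \subset K :|: [set y] by apply: subset_trans BD (subsetIr _ _).
have zF : z \in F by apply: subsetP zpB; apply: phi_sub.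
have zK : z \notin K by move: zD; rewrite in_setI zF in_setU negb_or => /andP[].
(* Without y, [B] would lie in the closed set [K], which would then contain z. *)
have yB : y \in B.
  apply: contraNT zK => yB; apply: subsetP zpB; apply: phi_sub KC.
  apply/subsetP=> b bB; have /setUP[//|/set1P by_] := subsetP BKy b bB.
  by rewrite -by_ bB in yB.
(* [B] lies in [N1], which contains no critical premise through y except those inside [phi C A]. *)
have BA : B \subset phi C A.
  apply: contraT => nBA; have /negP[] : ~~ (B \subset N1).
    by apply: nN1; rewrite !inE yB nBA andbT; apply/existsP; exists z.
  apply: subset_trans BKy _; rewrite subUset sub1set (subsetP AN1) // andbT.
  exact: subsetIl.
(* [K] contains [phi C A] except for y and x; z lies in [phi C A] but not in [K], and differs from
   y, which is in [B]. *)
have zx : z = x.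
  apply/eqP; apply: contraNT zK => zx; apply: inK => //.
    by apply: subsetP zpB; apply: phi_sub (phi_closed _ clC).
  by apply: contraNneq zB => ->.
by rewrite zx in cB; rewrite -(critical_generator_inj cA cB BA).
Qed.

Lemma critical_searchP Ds :
  (forall x A, A \in critical_generators C x ->
     exists2 D, D \in Ds & extreme_by s (hull s D x) = A) ->
  lists (critical_search s Ds) (critical_base C).
Proof.
move=> H; split.
  apply: (foldl_inv (P := uniq)) => // acc D uacc.
  apply: (foldl_inv (P := uniq)) => // {uacc}acc x uacc.
  by rewrite /add_critical; case: ifP => // /andP[_ ni] /=; rewrite ni.
move=> i; apply/idP/imset2P => [|[x A _ cA ->{i}]].
  suff: {subset critical_search s Ds <= critical_base C}.
    by move=> sub /sub /imset2P[x A xT cA ->]; exists x A.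
  pose P (acc : seq (impl T)) := {subset acc <= critical_base C}.
  apply: (foldl_inv (P := P)) => // acc D sacc.
  apply: (foldl_inv (P := P)) => // {sacc}acc x sacc.
  rewrite /add_critical; case: ifP => // /andP[cx _] j; rewrite inE.
  case/predU1P=> [->|/sacc//]; apply/imset2P.
  by exists x (extreme_by s (hull s D x)) => //; rewrite -critical_byE.
have [D DDs EA] := H _ _ cA.
have sub acc D' x' : {subset acc <= add_critical s D' x' acc}.
  by move=> j jacc; rewrite /add_critical; case: ifP => // _; rewrite inE jacc orbT.
apply: (mem_foldl (u := D)) DDs _ => [acc u|acc].
  by apply: mem_foldl_sub => acc' x'; apply: sub.
apply: (mem_foldl (u := x)) (mem_enum _ _) _ => [acc' u|acc']; first exact: sub.
rewrite /add_critical /= EA critical_byE cA /=.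
by case: ifPn => [_|/negPn//]; rewrite inE eqxx.
Qed.

End ConvexGeometry.

Lemma critical_search_correct (T : finType) (C : {set {set T}}) s k :
  acyclic_convex_geometry C ->
  premise_degree C <= k \/ conclusion_degree C <= k -> s =i irr C ->
  lists (critical_search s (regions (meets s k.+1))) (critical_base C).
Proof.
case=> clC [S IBS acyS] dk sE; apply: (critical_searchP clC sE) => x A cA.
case: dk => dk.
  exact: (premise_region clC IBS acyS sE dk cA).
exact: (conclusion_region clC IBS acyS sE dk cA).
Qed.

(** * Polynomial-time functions on trees *)

Section PolynomialBounds.
Implicit Types f g : nat -> nat.

(** Equality with a polynomial over the naturals, rather than a bound by one, makes [f] monotone, so
    size bounds can be substituted into it. *)
Definition polyb f : Prop := exists q : {poly nat}, forall n, f n = q.[n]%R.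

Lemma polyb_const c : polyb (fun=> c).
Proof. by exists (c%:P)%R => n; rewrite hornerC. Qed.

Lemma polyb_id : polyb id.
Proof. by exists 'X%R => n; rewrite hornerX. Qed.

Lemma polyb_add f g : polyb f -> polyb g -> polyb (fun n => f n + g n).
Proof. by case=> p pE [q qE]; exists (p + q)%R => n; rewrite hornerD -pE -qE. Qed.

Lemma polyb_mul f g : polyb f -> polyb g -> polyb (fun n => f n * g n).
Proof. by case=> p pE [q qE]; exists (p * q)%R => n; rewrite hornerM -pE -qE. Qed.

Lemma polyb_comp f g : polyb f -> polyb g -> polyb (fun n => f (g n)).
Proof. by case=> p pE [q qE]; exists (p \Po q)%R => n; rewrite horner_comp -qE pE. Qed.

Lemma polyb_mono f m n : polyb f -> m <= n -> f m <= f n.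
Proof.
case=> q qE mn; rewrite !qE !horner_coef.
elim/big_ind2: _ => // [a b c d ab cd|i _]; first exact: leq_add.
apply: leq_mul => //; elim: (nat_of_ord i) => // j IH.
by rewrite !GRing.exprS; apply: leq_mul.
Qed.

End PolynomialBounds.

Create HintDb pt.
#[export] Hint Resolve polyb_const polyb_id polyb_add polyb_mul : pt.

Lemma polyb_succ f : polyb f -> polyb (fun n => (f n).+1).
Proof. by move=> pf; apply: (polyb_add (polyb_const 1) pf). Qed.
#[export] Hint Resolve polyb_succ : pt.

Lemma left_tree_size u : tree_size (left_tree u) <= tree_size u.
Proof. by case: u => //= u1 u2; lia. Qed.

Lemma right_tree_size u : tree_size (right_tree u) <= tree_size u.
Proof. by case: u => //= u1 u2; lia. Qed.

Lemma enc_bool_size b : tree_size (enc_bool b) <= 3.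
Proof. by case: b. Qed.

Definition is_node (u : tree) : bool := if u is Node _ _ then true else false.

Lemma is_node_enc_bool b : is_node (enc_bool b) = b.
Proof. by case: b. Qed.

(** * Time-bounded execution and the basic polynomial-time functions *)

Definition exec_within p st n st' := exists2 t, exec p st t st' & t <= n.

Lemma exec_within_seq p1 p2 st n1 st1 n2 st2 :
  exec_within p1 st n1 st1 -> exec_within p2 st1 n2 st2 ->
  exec_within (CSeq p1 p2) st (n1 + n2).+1 st2.
Proof.
case=> t1 e1 l1 [t2 e2 l2]; exists (t1 + t2).+1; first exact: ExecSeq e1 e2.
by rewrite ltnS leq_add.
Qed.

Lemma exec_within_assign x e st :
  exec_within (CAssign x e) st (eval_cost st e).+1 (update st x (eval st e)).
Proof. by exists (eval_cost st e).+1 => //; apply: ExecAssign. Qed.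

Lemma exec_within_le p st m n st' :
  exec_within p st m st' -> m <= n -> exec_within p st n st'.
Proof. by case=> t e tm mn; exists t => //; apply: leq_trans mn. Qed.

(* Register 0 carries the argument and then the value; registers from r on are
   left untouched, so a caller can keep its own data there. *)
Definition computes (p : com) (r : nat) (b : nat -> nat) (f : tree -> tree) :=
  forall st, exists st',
    [/\ exec_within p st (b (tree_size (st 0))) st', st' 0 = f (st 0),
        tree_size (f (st 0)) <= b (tree_size (st 0))
      & forall x, r <= x -> st' x = st x].

Definition PT (f : tree -> tree) : Prop :=
  exists p r b, [/\ polyb b, 0 < r & computes p r b f].

Lemma PT_ext f g : f =1 g -> PT f -> PT g.
Proof.
move=> fg [p [r [b [pb r0 H]]]]; exists p, r, b; split=> // st.
by have [st' [? ? ? ?]] := H st; exists st'; rewrite -fg.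
Qed.

Lemma PT_size f : PT f -> exists2 b, polyb b & forall v, tree_size (f v) <= b (tree_size v).
Proof.
case=> p [r [b [pb _ H]]]; exists b => // v.
by have [st' []] := H (fun=> v).
Qed.

Lemma PT_comp f g : PT f -> PT g -> PT (fun v => g (f v)).
Proof.
case=> [p [r [b [pb r0 H]]]] [p' [r' [b' [pb' r0' H']]]].
exists (CSeq p p'), (maxn r r'), (fun n => (b n + b' (b n)).+1); split.
- by apply: polyb_succ; apply: polyb_add => //; apply: polyb_comp.
- by rewrite leq_max r0.
move=> st; have [st1 [e1 v1 s1 k1]] := H st.
have [st2 [e2 v2 s2 k2]] := H' st1; rewrite v1 in e2 v2 s2.
have le2 : b' (tree_size (f (st 0))) <= b' (b (tree_size (st 0))) by apply: polyb_mono.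
exists st2; split=> //.
- by apply: exec_within_le (exec_within_seq e1 e2) _; lia.
- by lia.
by move=> x; rewrite geq_max => /andP[rx rx']; rewrite k2 ?k1.
Qed.

Lemma PT_id : PT id.
Proof.
exists CSkip, 1, (fun n => n + 1); split=> //; first by auto with pt.
move=> st; exists st; split=> //; last by lia.
by exists 1; [apply: ExecSkip | lia].
Qed.

(** The two equations on [st] say that the value and the cost of [e] depend on register 0 only. *)
Lemma PT_expr e (b : nat -> nat) : polyb b ->
  (forall st, eval st e = eval (fun=> st 0) e) ->
  (forall v, eval_cost (fun=> v) e <= b (tree_size v)) ->
  (forall st, eval_cost st e = eval_cost (fun=> st 0) e) ->
  PT (fun v => eval (fun=> v) e).
Proof.
move=> pb eE cb cE; exists (CAssign 0 e), 1, (fun n => (b n).+1).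
split=> //; first by auto with pt.
move=> st; exists (update st 0 (eval st e)); split.
- by apply: exec_within_le (exec_within_assign _ _ _) _; rewrite cE ltnS.
- by rewrite /update /= eE.
- apply: leqW; apply: leq_trans (cb _); case: e {eE cb cE} => * /=; lia.
by move=> x; rewrite /update; case: x.
Qed.

Lemma PT_left : PT left_tree.
Proof.
apply: (PT_expr (e := EHd (EVar 0)) (b := fun n => n + n)) => //.
  by auto with pt.
by move=> v /=; have := left_tree_size v; lia.
Qed.

Lemma PT_right : PT right_tree.
Proof.
apply: (PT_expr (e := ETl (EVar 0)) (b := fun n => n + n)) => //.
  by auto with pt.
by move=> v /=; have := right_tree_size v; lia.
Qed.

Lemma PT_leaf : PT (fun=> Leaf).
Proof. by apply: (PT_expr (e := ENil) (b := fun=> 1)) => //; auto with pt. Qed.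

Lemma PT_eqb : PT (fun v => enc_bool (tree_eqb (left_tree v) (right_tree v))).
Proof.
apply: (PT_expr (e := EEq (EHd (EVar 0)) (ETl (EVar 0)))
   (b := fun n => 3 + (n + n + (n + n)))) => //.
  by auto 7 with pt.
move=> v /=; have := left_tree_size v; have := right_tree_size v.
by have := enc_bool_size (tree_eqb (left_tree v) (right_tree v)); lia.
Qed.

Lemma PT_node f g : PT f -> PT g -> PT (fun v => Node (f v) (g v)).
Proof.
case=> [p [r [b [pb r0 H]]]] [p' [r' [b' [pb' r0' H']]]].
(* Registers from [m] on are untouched by both programs: [m] saves the argument, [m.+1] the first
   value. *)
pose m := maxn r r'.
exists (CSeq (CAssign m (EVar 0)) (CSeq p (CSeq (CAssign m.+1 (EVar 0))
  (CSeq (CAssign 0 (EVar m)) (CSeq p'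
  (CAssign 0 (ECons (EVar m.+1) (EVar 0)))))))), m.+2,
  (fun n => 20 + (n + n + (b n + b n + (b n + b n) + (b' n + b' n + b' n)))).
split=> //; first by auto 12 with pt.
move=> st; set st0 := update st m (st 0).
have m0 : m != 0 by rewrite /m; lia.
have [st1 [e1 v1 s1 k1]] := H st0.
set st2 := update st1 m.+1 (st1 0).
set st3 := update st2 0 (st2 m).
have [st4 [e4 v4 s4 k4]] := H' st3.
have st00 : st0 0 = st 0 by rewrite /st0 /update eq_sym (negbTE m0).
have st1m : st1 m = st 0 by rewrite k1 ?leq_maxl // /st0 /update eqxx.
have st2m : st2 m = st 0 by rewrite /st2 /update ltn_eqF.
have st30 : st3 0 = st 0 by rewrite /st3 /update /= st2m.
have st4m : st4 m.+1 = f (st 0).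
  rewrite k4; last by rewrite /m; lia.
  by rewrite /st3 /update /= /st2 /update eqxx v1 st00.
rewrite st00 in e1 v1 s1; rewrite st30 in e4 v4 s4.
exists (update st4 0 (Node (f (st 0)) (g (st 0)))); split.
- have e5 := exec_within_assign 0 (ECons (EVar m.+1) (EVar 0)) st4.
  rewrite /= st4m v4 in e5.
  have e := exec_within_seq (exec_within_assign m (EVar 0) st)
    (exec_within_seq e1 (exec_within_seq (exec_within_assign m.+1 (EVar 0) st1)
      (exec_within_seq (exec_within_assign 0 (EVar m) st2)
        (exec_within_seq e4 e5)))).
  apply: exec_within_le e _.
  by rewrite /= v1 -/st2 st2m; lia.
- by [].
- by rewrite /=; lia.
move=> x mx; have x0 : x != 0 by lia.
rewrite {1}/update (negbTE x0) k4; last by rewrite /m in mx; lia.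
rewrite /st3 {1}/update (negbTE x0) /st2 {1}/update gtn_eqF //.
rewrite k1; last by rewrite /m in mx; lia.
by rewrite /st0 /update gtn_eqF //; lia.
Qed.

Lemma PT_if c f g : PT c -> PT f -> PT g ->
  PT (fun v => if is_node (c v) then f v else g v).
Proof.
move=> Pc [p [r [b [pb r0 H]]]] [p' [r' [b' [pb' r0' H']]]].
(* The argument is first paired with its verdict; the test reads the head and both branches start
   from the tail. *)
pose F v := if is_node (left_tree v) then f (right_tree v) else g (right_tree v).
apply: (PT_comp (g := F) (PT_node Pc PT_id)) => {Pc c}.
pose tl := CAssign 0 (ETl (EVar 0)).
exists (CIf (EHd (EVar 0)) (CSeq tl p) (CSeq tl p')), (maxn r r'),
  (fun n => 4 + (n + n + (n + n)) + (b n + b' n)).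
split; [by auto 9 with pt | by rewrite leq_max r0 | move=> st].
set st1 := update st 0 (right_tree (st 0)).
have et : exec_within tl st _ st1 := exec_within_assign _ _ _.
have sl := left_tree_size (st 0); have sr := right_tree_size (st 0).
have mb := polyb_mono pb sr; have mb' := polyb_mono pb' sr.
rewrite /F -[is_node _]/(holds st (EHd (EVar 0))); case: ifP => hE.
  have [st2 [e2 v2 s2 k2]] := H st1; exists st2; split=> //; last first.
  - by move=> x; rewrite geq_max => /andP[rx _]; rewrite k2 // /st1 /update gtn_eqF //; lia.
  - by rewrite /st1 /update /= in s2; lia.
  have [t et2 lt] := exec_within_seq et e2.
  exists (eval_cost st (EHd (EVar 0)) + t).+1; first by apply: ExecIf; rewrite hE.
  by rewrite /st1 /update /= in lt *; lia.
have [st2 [e2 v2 s2 k2]] := H' st1; exists st2; split=> //; last first.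
- by move=> x; rewrite geq_max => /andP[_ rx]; rewrite k2 // /st1 /update gtn_eqF //; lia.
- by rewrite /st1 /update /= in s2; lia.
have [t et2 lt] := exec_within_seq et e2.
exists (eval_cost st (EHd (EVar 0)) + t).+1; first by apply: ExecIf; rewrite hE.
by rewrite /st1 /update /= in lt *; lia.
Qed.

(* The step function receives the whole remaining list, which makes distinct
   positions of a list of identical items distinguishable. *)
Fixpoint tfold (B : tree -> tree -> tree) (a l : tree) : tree :=
  if l is Node _ l' then tfold B (B a l) l' else a.

(** Growth is additive in the state [a]: a step that doubled it would reach exponential size after
    linearly many iterations. *)
Definition grows (g : nat -> nat) (F : tree -> tree) :=
  forall a w, tree_size (F (Node a w)) <= tree_size a + g (tree_size w).

Lemma tfold_size B a l G :
  (forall a l', tree_size l' <= tree_size l -> tree_size (B a l') <= tree_size a + G) ->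
  tree_size (tfold B a l) <= tree_size a + tree_size l * G.
Proof.
elim: l a => [|e _ l IH] a H /=; first by lia.
apply: leq_trans (IH _ _) _ => [a' l' ll'|]; first by apply: H; rewrite /=; lia.
by have := H a (Node e l) (leqnn _); rewrite /=; nia.
Qed.

Definition fold_loop p r : com :=
  CWhile (EVar r)
    (CSeq (CAssign 0 (ECons (EVar 0) (ECons (EVar r) (EVar r.+1))))
      (CSeq p (CAssign r (ETl (EVar r))))).

(** Register 0 holds the state, [r] the remaining list, [r.+1] the environment. The quantity
    [tree_size a + tree_size l * G] never increases along the loop, so [A] bounds every state and
    [W] every input of the body. *)
Lemma fold_loopP p r b F env L G A : polyb b -> 0 < r -> computes p r b F ->
  (forall a l, tree_size l <= L ->
     tree_size (F (Node a (Node l env))) <= tree_size a + G) ->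
  let W := A + L + tree_size env + 2 in
  forall l a st, st 0 = a -> st r = l -> st r.+1 = env ->
  tree_size l <= L -> tree_size a + tree_size l * G <= A ->
  exists st',
    [/\ exec_within (fold_loop p r) st (tree_size l * (b W + 10 * W)) st',
        st' 0 = tfold (fun a l => F (Node a (Node l env))) a l
      & forall x, r.+2 <= x -> st' x = st x].
Proof.
move=> pb r0 H Fg W; elim=> [|e _ l IH] a st st0 str ste lL aA.
  exists st; split=> //; exists (eval_cost st (EVar r)).+1.
    by apply: ExecWhileDone; rewrite /holds /= str.
  by rewrite /= str /W /=; lia.
set u := Node a (Node (Node e l) env).
set st1 := update st 0 u.
have e1 := exec_within_assign 0 (ECons (EVar 0) (ECons (EVar r) (EVar r.+1))) st.
rewrite /= st0 str ste -/u -/st1 in e1.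
have [st2 [e2 v2 s2 k2]] := H st1.
have st10 : st1 0 = u by [].
rewrite st10 in e2 v2 s2.
have st2r : st2 r = Node e l.
  by rewrite k2 // /st1 /update gtn_eqF.
have st2e : st2 r.+1 = env by rewrite k2.
have e3 := exec_within_assign r (ETl (EVar r)) st2.
set st3 := update st2 r _ in e3; rewrite /= st2r /= in e3.
have ga : tree_size (F u) <= tree_size a + G by apply: Fg.
rewrite /= in lL aA.
have [|||||st4 [e4 v4 k4]] := IH (F u) st3.
- by rewrite /st3 /update ltn_eqF.
- by rewrite /st3 /update eqxx /= st2r.
- by rewrite /st3 /update gtn_eqF.
- by lia.
- by nia.
have [t1 E1 l1] := exec_within_seq e1 (exec_within_seq e2 e3).
case: e4 => t2 E2 l2.
have sizeu : tree_size u <= W by rewrite /u /W /=; nia.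
have bu : b (tree_size u) <= b W by apply: polyb_mono.
exists st4; split.
- exists (eval_cost st (EVar r) + t1 + t2).+1.
    by apply: ExecWhileLoop E1 E2; rewrite /holds /= str.
  move: (b W) (b (tree_size u)) l1 l2 bu => bW bU.
  by rewrite /= str /= /u /W /=; nia.
- by rewrite v4.
move=> x rx; rewrite k4 // /st3 /update gtn_eqF; last by lia.
by rewrite k2 ?/st1 /update ?gtn_eqF //; lia.
Qed.

Lemma PT_fold F g : PT F -> polyb g -> grows g F ->
  PT (fun v => tfold (fun a l => F (Node a (Node l (right_tree (right_tree v)))))
                 (left_tree v) (left_tree (right_tree v))).
Proof.
case=> p [r [b [pb r0 H]]] pg Fg.
(* The remaining list and the environment have size at most n each, hence their pair at most 2n + 1;
   at most n iterations each add [g] of that to the state. *)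
pose A n := n + n * g (n + n + 1).
pose W n := A n + n + n + 2.
pose prep := CSeq (CAssign r (EHd (ETl (EVar 0))))
  (CSeq (CAssign r.+1 (ETl (ETl (EVar 0)))) (CAssign 0 (EHd (EVar 0)))).
have pA : polyb A.
  by apply: polyb_add polyb_id (polyb_mul polyb_id (polyb_comp pg _)); auto with pt.
have pW : polyb W by rewrite /W; auto with pt.
exists (CSeq prep (fold_loop p r)), r.+2,
  (fun n => 20 + 10 * n + n * (b (W n) + 10 * W n) + A n).
have pbW := polyb_comp pb pW.
split=> //; first by auto 9 with pt.
move=> st.
have e1 := exec_within_assign r (EHd (ETl (EVar 0))) st.
set st1 := update st r _ in e1.
have e2 := exec_within_assign r.+1 (ETl (ETl (EVar 0))) st1.
set st2 := update st1 r.+1 _ in e2.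
have e3 := exec_within_assign 0 (EHd (EVar 0)) st2.
set st3 := update st2 0 _ in e3.
have st10 : st1 0 = st 0 by rewrite /st1 /update ltn_eqF.
have st20 : st2 0 = st 0 by rewrite /st2 /update /= st10.
have st3r : st3 r = left_tree (right_tree (st 0)).
  by rewrite /st3 {1}/update gtn_eqF // /st2 /update ltn_eqF // /st1 /update eqxx.
have st3e : st3 r.+1 = right_tree (right_tree (st 0)).
  by rewrite /st3 {1}/update /= /st2 /update eqxx /= st10.
have st30 : st3 0 = left_tree (st 0) by rewrite /st3 /update /= st20.
rewrite /= st10 in e2; rewrite /= st20 in e3; rewrite /= in e1.
set v := st 0 in e1 e2 e3 st3r st3e st30 *.
have s1 := left_tree_size v; have s2 := right_tree_size v.
have s3 := left_tree_size (right_tree v).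
have s4 := right_tree_size (right_tree v).
set n := tree_size v in s1 s2 *.
have Fg' a l : tree_size l <= n ->
    tree_size (F (Node a (Node l (right_tree (right_tree v))))) <= tree_size a + g (n + n + 1).
  move=> ln; apply: leq_trans (Fg _ _) _; rewrite leq_add2l.
  by apply: polyb_mono => //=; lia.
have le_A : tree_size (left_tree v) + tree_size (left_tree (right_tree v)) * g (n + n + 1) <= A n.
  by rewrite /A; nia.
have [||st4 [e4 v4 k4]] := fold_loopP (L := n) (A := A n) pb r0 H Fg' st30 st3r st3e.
- by lia.
- exact: le_A.
have leW : A n + n + tree_size (right_tree (right_tree v)) + 2 <= W n.
  by rewrite /W; lia.
have leb := polyb_mono pb leW.
exists st4; split=> //.
- have e := exec_within_seq (exec_within_seq e1 (exec_within_seq e2 e3)) e4.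
  apply: exec_within_le e _.
  have : tree_size (left_tree (right_tree v)) *
      (b (A n + n + tree_size (right_tree (right_tree v)) + 2) +
       10 * (A n + n + tree_size (right_tree (right_tree v)) + 2)) <=
      n * (b (W n) + 10 * W n) by apply: leq_mul; lia.
  by rewrite -!/n; lia.
- apply: leq_trans (tfold_size (G := g (n + n + 1)) _ _) _.
    by move=> a l ll; apply: Fg'; lia.
  by lia.
move=> x rx; rewrite k4 // /st3 /update (gtn_eqF (leq_ltn_trans (leq0n r.+1) rx)).
rewrite /st2 /update gtn_eqF // /st1 /update gtn_eqF //; lia.
Qed.

(** * Combinators for tests, nested loops and maps *)

Definition PTb (p : tree -> bool) : Prop := PT (fun v => enc_bool (p v)).

(* [F v a] updates the state [a] of a loop: it may grow by an amount bounded in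
   terms of [v] alone, so that iterating it stays polynomial. *)
Definition PTstep (F : tree -> tree -> tree) : Prop :=
  PT (fun z => F (right_tree z) (left_tree z)) /\
  exists2 g, polyb g & forall v a, tree_size (F v a) <= tree_size a + g (tree_size v).

Lemma PT_left_comp f : PT f -> PT (fun v => left_tree (f v)).
Proof. by move=> /PT_comp/(_ PT_left). Qed.

Lemma PT_right_comp f : PT f -> PT (fun v => right_tree (f v)).
Proof. by move=> /PT_comp/(_ PT_right). Qed.

Lemma PT_ifb c f g : PTb c -> PT f -> PT g ->
  PT (fun v => if c v then f v else g v).
Proof.
move=> Pc Pf Pg; apply: PT_ext (PT_if Pc Pf Pg) => v.
by rewrite is_node_enc_bool.
Qed.

Lemma PTb_true : PTb xpredT.
Proof. exact: (PT_node PT_leaf PT_leaf). Qed.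

Lemma PTb_node f : PT f -> PTb (fun v => is_node (f v)).
Proof.
move=> Pf; apply: PT_ext (PT_if Pf PTb_true PT_leaf) => v.
by case: (is_node _).
Qed.

Lemma PTb_and p q : PTb p -> PTb q -> PTb (fun v => p v && q v).
Proof.
move=> Pp Pq; apply: PT_ext (PT_ifb Pp Pq PT_leaf) => v.
by case: (p v).
Qed.

Lemma PTb_neg p : PTb p -> PTb (fun v => ~~ p v).
Proof.
move=> Pp; apply: PT_ext (PT_ifb Pp PT_leaf PTb_true) => v.
by case: (p v).
Qed.

Lemma PTb_imply p q : PTb p -> PTb q -> PTb (fun v => p v ==> q v).
Proof.
move=> Pp Pq; apply: PT_ext (PT_ifb Pp Pq PTb_true) => v.
by case: (p v).
Qed.

Lemma PTb_eqb f g : PT f -> PT g -> PTb (fun v => tree_eqb (f v) (g v)).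
Proof. by move=> Pf Pg; have := PT_comp (PT_node Pf Pg) PT_eqb. Qed.

Lemma PTstep_id : PTstep (fun v a => a).
Proof.
split; first exact: PT_left.
by exists (fun=> 0) => [|v a]; [exact: polyb_const | rewrite addn0].
Qed.

Lemma PTstep_const f : PT f -> PTstep (fun v a => f v).
Proof.
move=> Pf; split; first by apply: PT_comp Pf; exact: PT_right.
have [b pb fb] := PT_size Pf; exists b => // v a.
by apply: leq_trans (fb v) _; apply: leq_addl.
Qed.

Lemma PTstep_cons f F : PT f -> PTstep F -> PTstep (fun v a => Node (f v) (F v a)).
Proof.
move=> Pf [PF [g pg Fg]]; split.
  by apply: PT_node PF; apply: PT_comp Pf; exact: PT_right.
have [b pb fb] := PT_size Pf; exists (fun n => (b n + g n).+1).
  by auto with pt.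
by move=> v a /=; have := fb v; have := Fg v a; lia.
Qed.

Lemma PTstep_if c F G : PTb (fun z => c (right_tree z) (left_tree z)) ->
  PTstep F -> PTstep G -> PTstep (fun v a => if c v a then F v a else G v a).
Proof.
move=> Pc [PF [f pf Ff]] [PG [g pg Gg]]; split; first exact: PT_ifb.
exists (fun n => f n + g n); first by auto with pt.
by move=> v a; have := Ff v a; have := Gg v a; case: ifP; lia.
Qed.

(** Steps are closed under iteration along a list, which allows nested loops on one shared state.
    The body receives the current suffix and the outer data as the pair [w]. *)
Lemma PTstep_fold B l :
  PTstep (fun w a => B (right_tree w) a (left_tree w)) -> PT l ->
  PTstep (fun v a => tfold (B v) a (l v)).
Proof.
move=> [PB [g pg Bg]] Pl; split.
  have gB : grows g (fun z => B (right_tree (right_tree z)) (left_tree z)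
                                (left_tree (right_tree z))).
    by move=> a w; apply: Bg.
  have := PT_comp (PT_node PT_left (PT_node (PT_comp PT_right Pl) PT_right))
    (PT_fold PB pg gB).
  exact.
have [b pb lb] := PT_size Pl.
exists (fun n => b n * g (b n + n + 1)).
  by apply: polyb_mul => //; apply: polyb_comp; auto with pt.
move=> v a; apply: leq_trans (tfold_size (G := g (b (tree_size v) + tree_size v + 1)) _ _) _.
  move=> a' l' ll; apply: leq_trans (Bg (Node l' v) a') _.
  by rewrite leq_add2l; apply: polyb_mono => //=; have := lb v; lia.
by rewrite leq_add2l leq_mul2r lb orbT.
Qed.

Lemma PT_step F i : PTstep F -> PT i -> PT (fun v => F v (i v)).
Proof. by move=> [PF _] Pi; exact: (PT_comp (PT_node Pi PT_id) PF). Qed.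

Fixpoint tall (p : tree -> bool) (l : tree) : bool :=
  if l is Node e l' then p e && tall p l' else true.

Lemma PTb_all p l : PTb (fun z => p (right_tree z) (left_tree z)) -> PT l ->
  PTb (fun v => tall (p v) (l v)).
Proof.
move=> Pp Pl.
(* The state is the verdict so far; once it is [Leaf], that is false, it stays so. *)
pose F v a := tfold (fun a l => if p v (left_tree l) then a else Leaf) a (l v).
have PF : PTstep F.
  apply: PTstep_fold Pl; apply: PTstep_if PTstep_id (PTstep_const PT_leaf).
  apply: PT_comp (PT_node _ _) Pp; last by do !apply: PT_right_comp; exact: PT_id.
  by apply/PT_left_comp/PT_left_comp/PT_right_comp/PT_id.
apply: PT_ext (PT_step PF PTb_true) => v; rewrite /F.
have tfold0 B k : tfold (fun a l => if B a l then a else Leaf) Leaf k = Leaf.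
  by elim: k => //= e _ k IH; rewrite if_same.
elim: (l v) => //= e _ k IH.
by case: (p v e) => /=; [exact: IH | exact: (tfold0 (fun _ l => p v (left_tree l)))].
Qed.

(** Folding with [Node] builds lists backwards; this reversal restores the order in [PT_sufmap]. *)
Lemma PT_rev f : PT f -> PT (fun v => tfold (fun a l => Node (left_tree l) a) Leaf (f v)).
Proof.
move=> Pf; apply: (PT_step (F := fun v a => tfold _ a (f v)) _ PT_leaf).
by apply: PTstep_fold Pf; apply: PTstep_cons PTstep_id; apply/PT_left_comp/PT_left.
Qed.

Fixpoint tsufmap (f : tree -> tree) (l : tree) : tree :=
  if l is Node _ l' then Node (f l) (tsufmap f l') else Leaf.

Lemma PT_sufmap f l : PT (fun z => f (right_tree z) (left_tree z)) -> PT l ->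
  PT (fun v => tsufmap (f v) (l v)).
Proof.
move=> Pf Pl.
pose F v a := tfold (fun a l => Node (f v l) a) a (l v).
have PF : PTstep F.
  by apply: PTstep_fold Pl; apply: PTstep_cons PTstep_id.
apply: PT_ext (PT_rev (PT_step PF PT_leaf)) => v; rewrite /F.
set rv := tfold (fun a l => Node (left_tree l) a).
have revE k a : rv Leaf (tfold (fun a l => Node (f v l) a) a k) =
    rv (tsufmap (f v) k) a.
  by elim: k a => //= e _ k IH a; rewrite IH.
by rewrite revE.
Qed.

Definition tmap (f : tree -> tree) (l : tree) : tree :=
  tsufmap (fun k => f (left_tree k)) l.

Lemma PT_map f l : PT (fun z => f (right_tree z) (left_tree z)) -> PT l ->
  PT (fun v => tmap (f v) (l v)).
Proof.
move=> Pf Pl; apply: PT_sufmap Pl.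
exact: (PT_comp (PT_node (PT_left_comp PT_left) PT_right) Pf).
Qed.

Fixpoint tsub (a b : tree) : bool :=
  if a is Node e a' then
    (is_node e ==> is_node (left_tree b)) && tsub a' (right_tree b)
  else true.

Lemma PTb_sub f g : PT f -> PT g -> PTb (fun v => tsub (f v) (g v)).
Proof.
move=> Pf Pg.
(* The state pairs the verdict so far with the unread part of the second vector. *)
pose B a l := Node
  (if is_node (left_tree l) ==> is_node (left_tree (right_tree a)) then left_tree a
   else Leaf) (right_tree (right_tree a)).
have PB : PTstep (fun v a => tfold B a (f v)).
  apply: PTstep_fold Pf; split.
    apply: PT_node; last by apply/PT_right_comp/PT_right_comp/PT_left.
    apply: PT_ifb PT_leaf; last by apply/PT_left_comp/PT_left.
    apply: PTb_imply; apply: PTb_node; last by apply/PT_left_comp/PT_right_comp/PT_left.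
    by apply/PT_left_comp/PT_left_comp/PT_right.
  exists (fun=> 3); first exact: polyb_const.
  move=> w [|a1 a2]; rewrite /B /=; first by rewrite if_same.
  by have := right_tree_size a2; case: ifP => _ /=; lia.
apply: PT_ext (PT_left_comp (PT_step PB (PT_node PTb_true Pg))) => v.
have tfold0 k b : left_tree (tfold B (Node Leaf b) k) = Leaf.
  by elim: k b => //= e _ k IH b; rewrite {2}/B /= if_same IH.
elim: (f v) (g v) => //= e _ k IH b; rewrite {2}/B /=.
by case: (_ ==> _); [exact: IH | rewrite tfold0].
Qed.

Ltac pt_step ops := first
  [ assumption
  | exact: PT_id | exact: PT_leaf | exact: PTb_true
  | match goal with H : PT ?f |- PT (fun z => ?f (@?h z)) =>
      apply: (@PT_comp h f _ H) end
  | apply: PT_left_comp | apply: PT_right_comp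
  | apply: PTb_and | apply: PTb_neg | apply: PTb_imply
  | apply: PTb_eqb | apply: PTb_sub | apply: PTb_all
  | apply: PT_map | apply: PT_sufmap | apply: PT_node | ops ].

(** * The algorithm on trees *)

(** Elements are represented by the vectors of their singletons, listed in [E], so that membership
    becomes [tsub]. *)
Definition tclosure E S A : tree :=
  tmap (fun z => enc_bool (tall (fun M => tsub A M ==> tsub z M) S)) E.

Lemma PT_closure E S A : PT E -> PT S -> PT A ->
  PT (fun v => tclosure (E v) (S v) (A v)).
Proof. by move=> PE PS PA; rewrite /tclosure; repeat pt_step fail. Qed.

Definition tclosed E S A : bool := tree_eqb (tclosure E S A) A.

Lemma PTb_closed E S A : PT E -> PT S -> PT A ->
  PTb (fun v => tclosed (E v) (S v) (A v)).
Proof. by move=> PE PS PA; apply: PTb_eqb => //; apply: PT_closure. Qed.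

Definition tdiff E A B : tree :=
  tmap (fun z => enc_bool (tsub z A && ~~ tsub z B)) E.

Lemma PT_diff E A B : PT E -> PT A -> PT B ->
  PT (fun v => tdiff (E v) (A v) (B v)).
Proof. by move=> PE PA PB; rewrite /tdiff; repeat pt_step fail. Qed.

Definition tmeet E A B : tree :=
  tmap (fun z => enc_bool (tsub z A && tsub z B)) E.

Lemma PT_meet E A B : PT E -> PT A -> PT B ->
  PT (fun v => tmeet (E v) (A v) (B v)).
Proof. by move=> PE PA PB; rewrite /tmeet; repeat pt_step fail. Qed.

Definition tjoin E A B : tree :=
  tmap (fun z => enc_bool (~~ tsub z A ==> tsub z B)) E.

Lemma PT_join E A B : PT E -> PT A -> PT B ->
  PT (fun v => tjoin (E v) (A v) (B v)).
Proof. by move=> PE PA PB; rewrite /tjoin; repeat pt_step fail. Qed.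

Ltac pt_set := first
  [ apply: PT_closure | apply: PTb_closed | apply: PT_diff
  | apply: PT_meet | apply: PT_join ].

Definition textreme E S F : tree :=
  tmap (fun e => enc_bool (tsub e F && tclosed E S (tdiff E F e))) E.

Lemma PT_extreme E S F : PT E -> PT S -> PT F ->
  PT (fun v => textreme (E v) (S v) (F v)).
Proof. by move=> PE PS PF; rewrite /textreme; repeat pt_step pt_set. Qed.

Definition thull E S D x : tree :=
  tmap (fun z => enc_bool
    (tall (fun M => tsub x (tclosure E S (tmeet E M D)) ==> tsub z M) S)) E.

Lemma PT_hull E S D x : PT E -> PT S -> PT D -> PT x ->
  PT (fun v => thull (E v) (S v) (D v) (x v)).
Proof. by move=> PE PS PD Px; rewrite /thull; repeat pt_step pt_set. Qed.

Definition tcritical E S A x : bool :=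
  [&& ~~ tsub x A, tsub x (tclosure E S A)
    & tall (fun a => tsub a A ==>
                     tclosed E S (tdiff E (tclosure E S A) (tjoin E a x))) E].

Lemma PTb_critical E S A x : PT E -> PT S -> PT A -> PT x ->
  PTb (fun v => tcritical (E v) (S v) (A v) (x v)).
Proof. by move=> PE PS PA Px; rewrite /tcritical; repeat pt_step pt_set. Qed.

Definition tmeet_all E S Ns : tree :=
  tfold (fun acc N =>
    tfold (fun acc M => Node (tmeet E (left_tree N) (left_tree M)) acc) acc S)
    Ns Ns.

Lemma PT_meet_all E S Ns : PT E -> PT S -> PT Ns ->
  PT (fun v => tmeet_all (E v) (S v) (Ns v)).
Proof.
move=> PE PS PNs; rewrite /tmeet_all.
apply: (PT_step (F := fun v a => tfold _ a (Ns v)) _ PNs); apply: PTstep_fold => //.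
apply: PTstep_fold; last by repeat pt_step pt_set.
by apply: PTstep_cons PTstep_id; repeat pt_step pt_set.
Qed.

Definition tmeets E S k : tree :=
  iter k (tmeet_all E S) (Node (tmap (fun=> enc_bool true) E) Leaf).

(** Here k is fixed: the program, built by induction on k, chains k copies of [tmeet_all], and its
    time bound depends on k. *)
Lemma PT_meets E S k : PT E -> PT S -> PT (fun v => tmeets (E v) (S v) k).
Proof.
move=> PE PS; elim: k => [|k IH]; last exact: PT_meet_all.
by repeat pt_step fail.
Qed.

Definition tregions E Ns : tree :=
  tfold (fun acc N =>
    tfold (fun acc y => Node (tjoin E (left_tree N) (left_tree y))
                          (Node (tdiff E (left_tree N) (left_tree y)) acc)) acc E)
    Leaf Ns.

Lemma PT_regions E Ns : PT E -> PT Ns -> PT (fun v => tregions (E v) (Ns v)).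
Proof.
move=> PE PNs; rewrite /tregions.
apply: (PT_step (F := fun v a => tfold _ a (Ns v)) _ PT_leaf).
apply: PTstep_fold => //.
apply: PTstep_fold; last by repeat pt_step pt_set.
apply: PTstep_cons; first by repeat pt_step pt_set.
by apply: PTstep_cons PTstep_id; repeat pt_step pt_set.
Qed.

Definition tadd_critical E S D x acc : tree :=
  let A := textreme E S (thull E S D x) in
  if tcritical E S A x && tall (fun j => ~~ tree_eqb (Node A x) j) acc
  then Node (Node A x) acc else acc.

Definition tsearch E S Ds : tree :=
  tfold (fun acc D =>
    tfold (fun acc x => tadd_critical E S (left_tree D) (left_tree x) acc) acc E)
    Leaf Ds.

Lemma PT_search E S Ds : PT E -> PT S -> PT Ds ->
  PT (fun v => tsearch (E v) (S v) (Ds v)).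
Proof.
move=> PE PS PDs; rewrite /tsearch.
apply: (PT_step (F := fun v a => tfold _ a (Ds v)) _ PT_leaf).
apply: PTstep_fold => //.
apply: PTstep_fold; last by repeat pt_step pt_set.
have PA : PT (fun w => textreme (E (right_tree (right_tree w)))
    (S (right_tree (right_tree w))) (thull (E (right_tree (right_tree w)))
    (S (right_tree (right_tree w))) (left_tree (left_tree (right_tree w)))
    (left_tree (left_tree w)))).
  by apply: PT_extreme; [| |apply: PT_hull]; repeat pt_step fail.
rewrite /tadd_critical; apply: PTstep_if PTstep_id.
  apply: PTb_and.
    apply: PTb_critical; try by repeat pt_step fail.
  apply: PTb_all PT_left; apply/PTb_neg/PTb_eqb; last exact: PT_left.
  apply: PT_node; last by repeat pt_step fail.
  exact: (PT_comp (PT_right_comp PT_right) PA).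
by apply: PTstep_cons PTstep_id; apply: PT_node => //; repeat pt_step fail.
Qed.

(** Two suffixes of a list are equal only at the same position, so comparing all pairs of suffixes
    of the unary list gives the rows of the identity matrix, which encode the singletons. *)
Definition tsingletons u : tree :=
  tsufmap (fun k => tsufmap (fun k' => enc_bool (tree_eqb k k')) u) u.

Definition algorithm k (v : tree) : tree :=
  let E := tsingletons (left_tree v) in
  tsearch E (right_tree v) (tregions E (tmeets E (right_tree v) k)).

Lemma PT_algorithm k : PT (algorithm k).
Proof.
have PE : PT (fun v => tsingletons (left_tree v)).
  by rewrite /tsingletons; repeat pt_step fail.
by apply: PT_search (PE) PT_right _; apply: PT_regions (PE) _;
  apply: PT_meets PE PT_right.
Qed.

(** * The tree algorithm simulates the algorithm on sets *)

Lemma tree_eqP t u : reflect (t = u) (tree_eqb t u).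
Proof.
elim: t u => [|t1 IH1 t2 IH2] [|u1 u2] /=; try by constructor.
by apply: (iffP andP) => [[/IH1-> /IH2->]|[/IH1-> /IH2->]].
Qed.

Lemma tfold_enc (U V : Type) (f : U -> tree) (g : V -> tree)
    (B : tree -> tree -> tree) (B' : U -> V -> U) a r :
  (forall a x k, B (f a) (Node (g x) k) = f (B' a x)) ->
  tfold B (f a) (enc_seq g r) = f (foldl B' a r).
Proof. by move=> H; elim: r a => //= x r IH a; rewrite -IH H. Qed.

Lemma tall_enc (U : Type) (f : U -> tree) p r :
  tall p (enc_seq f r) = all (fun x => p (f x)) r.
Proof. by elim: r => //= x r ->. Qed.

Lemma tmap_enc (U : Type) (f : U -> tree) g r :
  tmap g (enc_seq f r) = enc_seq (fun x => g (f x)) r.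
Proof. by rewrite /tmap; elim: r => //= x r ->. Qed.

Lemma eq_enc_seq (U : eqType) (f g : U -> tree) r :
  {in r, f =1 g} -> enc_seq f r = enc_seq g r.
Proof.
elim: r => //= x r IH fg; rewrite fg ?mem_head // IH // => y yr.
by apply: fg; rewrite inE yr orbT.
Qed.

Lemma enc_seq_map (U V : Type) (f : V -> tree) (h : U -> V) r :
  enc_seq f (map h r) = enc_seq (fun x => f (h x)) r.
Proof. by elim: r => //= x r ->. Qed.

Section Encodings.
Variable T : finType.
Implicit Types (A B D F M N : {set T}) (x y z : T) (Ns Ds : seq {set T}).

Lemma enc_setE A : enc_set A = enc_seq (fun x => enc_bool (x \in A)) (enum T).
Proof. exact: enc_seq_map. Qed.

Lemma tsub_enc A B : tsub (enc_set A) (enc_set B) = (A \subset B).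
Proof.
transitivity (all (fun x => (x \in A) ==> (x \in B)) (enum T)).
  rewrite !enc_setE; elim: (enum T) => //= x r ->.
  by rewrite !is_node_enc_bool.
apply/allP/subsetP => H x; last by move=> _; apply/implyP/H.
by apply/implyP/H; rewrite mem_enum.
Qed.

Lemma enc_set_inj : injective (@enc_set T).
Proof.
move=> A B eAB; apply/eqP; rewrite eqEsubset.
by rewrite -!tsub_enc eAB !tsub_enc subxx.
Qed.

Lemma tree_eqb_enc_set A B : tree_eqb (enc_set A) (enc_set B) = (A == B).
Proof.
by apply/tree_eqP/eqP => [/enc_set_inj|->].
Qed.

Definition enc_singletons : tree :=
  enc_seq (fun x => enc_set [set x]) (enum T).

Lemma tmap_singletons p :
  tmap (fun e => enc_bool (p e)) enc_singletons =
  enc_set [set x : T | p (enc_set [set x])].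
Proof.
by rewrite tmap_enc enc_setE; apply: eq_enc_seq => x _; rewrite inE.
Qed.

Lemma tsub1_enc x A : tsub (enc_set [set x]) (enc_set A) = (x \in A).
Proof. by rewrite tsub_enc sub1set. Qed.

Lemma tmeet_enc A B :
  tmeet enc_singletons (enc_set A) (enc_set B) = enc_set (A :&: B).
Proof.
by rewrite /tmeet tmap_singletons; congr enc_set; apply/setP=> x;
  rewrite !inE !tsub1_enc.
Qed.

Lemma tjoin_enc A B :
  tjoin enc_singletons (enc_set A) (enc_set B) = enc_set (A :|: B).
Proof.
by rewrite /tjoin tmap_singletons; congr enc_set; apply/setP=> x;
  rewrite !inE !tsub1_enc; case: (x \in A).
Qed.

Lemma tdiff_enc A B :
  tdiff enc_singletons (enc_set A) (enc_set B) = enc_set (A :\: B).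
Proof.
by rewrite /tdiff tmap_singletons; congr enc_set; apply/setP=> x;
  rewrite !inE !tsub1_enc andbC.
Qed.

Variable s : seq {set T}.
Local Notation E := enc_singletons.
Local Notation S := (enc_seq (@enc_set T) s).

Lemma tclosure_enc A : tclosure E S (enc_set A) = enc_set (closure_by s A).
Proof.
rewrite /tclosure tmap_singletons; congr enc_set; apply/setP=> x.
rewrite !inE tall_enc; apply: eq_all => M.
by rewrite tsub_enc tsub1_enc.
Qed.

Lemma tclosed_enc A : tclosed E S (enc_set A) = closed_by s A.
Proof. by rewrite /tclosed tclosure_enc tree_eqb_enc_set. Qed.

Lemma textreme_enc A : textreme E S (enc_set A) = enc_set (extreme_by s A).
Proof.
rewrite /textreme tmap_singletons; congr enc_set; apply/setP=> x.
by rewrite !inE tdiff_enc tclosed_enc tsub1_enc.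
Qed.

Lemma thull_enc D x :
  thull E S (enc_set D) (enc_set [set x]) = enc_set (hull s D x).
Proof.
rewrite /thull tmap_singletons; congr enc_set; apply/setP=> z.
rewrite !inE tall_enc; apply: eq_all => M.
by rewrite tmeet_enc tclosure_enc !tsub1_enc.
Qed.

Lemma tcritical_enc A x :
  tcritical E S (enc_set A) (enc_set [set x]) = critical_by s A x.
Proof.
rewrite /tcritical tclosure_enc !tsub1_enc tall_enc; congr [&& _, _ & _].
by apply: eq_all => a; rewrite tjoin_enc tdiff_enc tclosed_enc tsub1_enc.
Qed.

Lemma tmeet_all_enc Ns :
  tmeet_all E S (enc_seq (@enc_set T) Ns) = enc_seq (@enc_set T) (meet_all s Ns).
Proof.
apply: tfold_enc => acc N k; apply: tfold_enc => {}acc M k' /=.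
by rewrite tmeet_enc.
Qed.

Lemma tmeets_enc k : tmeets E S k = enc_seq (@enc_set T) (meets s k).
Proof.
elim: k => [|k IH]; last by rewrite /tmeets iterS -/(tmeets E S k) IH tmeet_all_enc.
by rewrite /tmeets /= (tmap_singletons xpredT).
Qed.

Lemma tregions_enc Ns :
  tregions E (enc_seq (@enc_set T) Ns) = enc_seq (@enc_set T) (regions Ns).
Proof.
rewrite /tregions -[Leaf]/(enc_seq (@enc_set T) [::]).
apply: tfold_enc => acc N k; apply: tfold_enc => {}acc y k' /=.
by rewrite tjoin_enc tdiff_enc.
Qed.

Lemma tadd_critical_enc D x acc :
  tadd_critical E S (enc_set D) (enc_set [set x]) (enc_seq (@enc_impl T) acc) =
  enc_seq (@enc_impl T) (add_critical s D x acc).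
Proof.
rewrite /tadd_critical thull_enc textreme_enc tcritical_enc tall_enc /add_critical /=.
set A := extreme_by _ _.
have -> : all (fun i => ~~ tree_eqb (Node (enc_set A) (enc_set [set x])) (enc_impl i)) acc
    = ((A, [set x]) \notin acc).
  elim: acc => //= -[B C] acc ->; rewrite !tree_eqb_enc_set.
  by rewrite inE negb_or xpair_eqE.
by case: ifP.
Qed.

Lemma tsearch_enc Ds :
  tsearch E S (enc_seq (@enc_set T) Ds) =
  enc_seq (@enc_impl T) (critical_search s Ds).
Proof.
rewrite /tsearch -[Leaf]/(enc_seq (@enc_impl T) [::]).
apply: tfold_enc => acc D k; apply: tfold_enc => {}acc x k' /=.
by rewrite tadd_critical_enc.
Qed.

End Encodings.

Lemma tsufmap_enc (U : eqType) (f : U -> tree) g r : uniq r ->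
  tsufmap g (enc_seq f r) = enc_seq (fun x => g (enc_seq f (drop (index x r) r))) r.
Proof.
elim: r => //= x r IH /andP[xr ur]; rewrite eqxx IH //; congr Node.
apply: eq_enc_seq => y yr; case: eqVneq => [xy|//].
by rewrite xy yr in xr.
Qed.

Lemma enc_unary_size (U : Type) (r : seq U) :
  tree_size (enc_seq (fun=> Leaf) r) = (size r).*2.+1.
Proof. by elim: r => //= x r ->; lia. Qed.

Lemma tsingletons_enc (T : finType) :
  tsingletons (enc_seq (fun _ : T => Leaf) (enum T)) = enc_singletons T.
Proof.
rewrite /tsingletons tsufmap_enc ?enum_uniq //; apply: eq_enc_seq => x _.
rewrite tsufmap_enc ?enum_uniq // enc_setE; apply: eq_enc_seq => y _.
(* All items being leaves, equal suffixes have equal lengths, hence equal positions in [enum T]. *)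
congr enc_bool; rewrite inE; apply/tree_eqP/eqP => [/(congr1 tree_size)|->//].
rewrite !enc_unary_size !size_drop => eq_size.
have xT : x \in enum T by rewrite mem_enum.
have yT : y \in enum T by rewrite mem_enum.
have eq_index : index y (enum T) = index x (enum T).
  by move: xT yT; rewrite -!index_mem; lia.
by rewrite -(nth_index x yT) eq_index nth_index.
Qed.

Lemma algorithm_enc (T : finType) (s : seq {set T}) k :
  algorithm k (enc_input s) =
  enc_seq (@enc_impl T) (critical_search s (regions (meets s k))).
Proof.
by rewrite /algorithm /= tsingletons_enc tmeets_enc tregions_enc tsearch_enc.
Qed.

(** * Size of the input and the final time bound *)

Lemma enc_seq_size (U : Type) (f : U -> tree) c r :
  (forall x, tree_size (f x) <= c) -> tree_size (enc_seq f r) <= size r * c.+1 + 1.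
Proof. by move=> fc; elim: r => //= x r IH; have := fc x; lia. Qed.

Lemma enc_input_size (T : finType) (s : seq {set T}) n : #|T| + size s <= n ->
  tree_size (enc_input s) <= n * 2 + n * (n * 4 + 2) + 3.
Proof.
rewrite cardE => Tsn /=.
have [Tn sn] : size (enum T) <= n /\ size s <= n.
  by split; apply: leq_trans Tsn; rewrite ?leq_addr ?leq_addl.
(* Each bit costs 4: at most 3 for [enc_bool] and 1 for the list node. *)
have set_size (A : {set T}) : tree_size (enc_set A) <= n * 4 + 1.
  apply: leq_trans (enc_seq_size (c := 3) _ enc_bool_size) _.
  by rewrite size_map; apply: leq_add (leq_mul Tn _) _.
have le1 := leq_trans (enc_seq_size (enum T) (fun=> leqnn (tree_size Leaf)))
  (leq_add (leq_mul Tn (leqnn 2)) (leqnn 1)).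
have le2 := leq_trans (enc_seq_size s set_size)
  (leq_add (leq_mul sn (leqnn _)) (leqnn 1)).
apply: leq_trans (_ : (n * 2 + 1 + (n * (n * 4 + 1).+1 + 1)).+1 <= _); last by lia.
by rewrite ltnS leq_add.
Qed.

Lemma poly_time_algorithm (P : forall T : finType, {set {set T}} -> Prop) k :
  (forall (T : finType) (C : {set {set T}}) s, P T C -> s =i irr C ->
     lists (critical_search s (regions (meets s k))) (critical_base C)) ->
  exists p, poly_time_critical_base P p.
Proof.
move=> correct; have [p [r [b [pb _ H]]]] := PT_algorithm k.
have [q qE] : polyb (fun n => b (n * 2 + n * (n * 4 + 2) + 3)).
  by apply: polyb_comp pb _; auto 9 with pt.
exists p, q => T C s PC [us sE].
have [st [[t e tb] st0 _ _]] := H (init_store (enc_input s)).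
exists t, st, (critical_search s (regions (meets s k))); split=> //.
- apply: leq_trans tb _; rewrite -qE; apply: polyb_mono => //.
  by apply: enc_input_size; rewrite -(eq_card sE) (card_uniqP us).
- by rewrite st0 algorithm_enc.
exact: correct.
Qed.

Theorem theorem2 (k : nat) :
  (exists p : com,
     poly_time_critical_base
       (fun (T : finType) (C : {set {set T}}) =>
          acyclic_convex_geometry C /\ premise_degree C <= k) p) /\
  (exists p : com,
     poly_time_critical_base
       (fun (T : finType) (C : {set {set T}}) =>
          acyclic_convex_geometry C /\ conclusion_degree C <= k) p).
Proof.
(* k sets separate [A] from the other candidates; the premise case intersects one more, which avoids
   x. *)
split; apply: (@poly_time_algorithm _ k.+1) => T C s [acg dk] sE;
  apply: critical_search_correct => //; by [left | right].
Qed.
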